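(* Let $(\mathfrak J,B)$ be a pseudo-Euclidean Jacobi-Jordan algebra over a field $\mathbb K$ of characteristic $0$. Then $$b_p\le \Delta_p\le \Delta-\Delta_a+\dim\big({}_zH^3_s(\mathfrak J,\mathbb K)\big).$$
   Context: A Jacobi-Jordan algebra is a vector space $\mathfrak J$ with a bilinear product $(x,y)\mapsto xy$ such that $xy=yx$ and $x(yz)+y(zx)+z(xy)=0$ for all $x,y,z$. It is pseudo-Euclidean if it is endowed with a nondegenerate symmetric bilinear form $B$ that is associative (invariant): $B(xy,z)=B(x,yz)$ for all $x,y,z$. $\Delta_p$ is the dimension of the space $F(\mathfrak J)$ of all invariant symmetric bilinear forms on $\mathfrak J$; $b_p$ is the dimension of the subspace of $F(\mathfrak J)$ spanned by the nondegenerate invariant symmetric bilinear forms; $\Delta$ is the dimension of the space $\mathrm{Der}(\mathfrak J)$ of derivations of $\mathfrak J$ (linear maps $D:\mathfrak J\to\mathfrak J$ with $D(xy)=D(x)y+xD(y)$); $\Delta_a$ is the dimension of the subspace of derivations $D$ that are skew-symmetric with respect to $B$: $B(D(x),y)=-B(x,D(y))$ for all $x,y$. ${}_zH^3_s(\mathfrak J,\mathbb K)={}_zZ^3_s(\mathfrak J,\mathbb K)/{}_zB^3(\mathfrak J,\mathbb K)$ (coefficients in the trivial module $\mathbb K$), where ${}_zZ^3_s(\mathfrak J,\mathbb K)$ is the space of symmetric trilinear forms $c$ on $\mathfrak J$ with $\sum_{1\le i<j\le4}c(x_ix_j,x_k,x_l)=0$ for all $x_1,\dots,x_4$, where $\{k<l\}=\{1,2,3,4\}\setminus\{i,j\}$,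 and ${}_zB^3(\mathfrak J,\mathbb K)$ is the space of trilinear forms $(x,y,z)\mapsto-\big(c(xy,z)+c(xz,y)+c(yz,x)\big)$ with $c$ a skew-symmetric bilinear form on $\mathfrak J$. *)

(* Defs.v *)
From HB Require Import structures.
From mathcomp Require Import all_boot all_order all_algebra.
From mathcomp Require Import boolp.
From mathcomp Require Import ring.
Set Implicit Arguments.
Unset Strict Implicit.
Unset Printing Implicit Defensive.
Import Order.TTheory GRing.Theory Num.Theory.
Local Open Scope ring_scope.

Section LinearAlgebra.
Variables (K : fieldType) (V : vectType K).

Lemma exists_spanning_seq (P : V -> Prop) :
  exists X : seq V,
    (forall v, v \in X -> P v) /\ (forall v, P v -> v \in <<X>>%VS).
Proof.
pose Q n := `[< exists2 X : seq V, forall v, v \in X -> P v & \dim <<X>> = n >].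
have Q0 : exists n, Q n.
  by exists (\dim <<([::] : seq V)>>); apply/asboolP; exists [::].
have QB n : Q n -> (n <= \dim {:V})%N.
  by move/asboolP => [X _ <-]; apply/dimvS/subvf.
case: (ex_maxnP Q0 QB) => n /asboolP[X XP dX] maxn.
exists X; split=> // v Pv.
have QvX : Q (\dim <<v :: X>>).
  by apply/asboolP; exists (v :: X) => // w; rewrite inE => /predU1P[->|/XP].
have sXvX : (<<X>> <= <<v :: X>>)%VS by rewrite span_cons addvSr.
have /eqP -> : <<X>>%VS == <<v :: X>>%VS.
  by rewrite eqEdim sXvX dX maxn.
by rewrite memv_span // mem_head.
Qed.

(* The linear span of the set of vectors satisfying P. *)
Definition span_pred (P : V -> Prop) : {vspace V} :=
  <<projT1 (cid (exists_spanning_seq P))>>%VS.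

Lemma sub_span_pred (P : V -> Prop) (v : V) : P v -> v \in span_pred P.
Proof. by rewrite /span_pred; case: cid => X /= [_ XP] /XP. Qed.

Lemma span_pred_min (P : V -> Prop) (U : {vspace V}) :
  (forall v, P v -> v \in U) -> (span_pred P <= U)%VS.
Proof.
rewrite /span_pred; case: cid => X /= [XP _] PU.
by apply/span_subvP => v /XP/PU.
Qed.

Lemma mem_span_pred (P : V -> Prop) :
  P 0 -> (forall a u v, P u -> P v -> P (a *: u + v)) ->
  forall v, v \in span_pred P <-> P v.
Proof.
move=> P0 PD v; split; last exact: sub_span_pred.
rewrite /span_pred; case: cid => X /= [XP _].
rewrite -[X]in_tupleE => /coord_span ->.
by elim/big_rec: _ => // i u _ Pu; apply: PD => //; apply/XP/mem_nth.
Qed.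

(* V / U is modelled on a complement of U; quotient_proj is the canonical
   projection, linear and onto with kernel U (see lker_quotient_proj and
   limg_quotient_proj), which characterizes the quotient up to isomorphism. *)
Definition quotient_space (U : {vspace V}) : vectType K := subvs_of U^C%VS.

Definition quotient_proj (U : {vspace V}) : 'Hom(V, quotient_space U) :=
  (linfun (vsproj U^C) \o daddv_pi U^C U)%VF.

Let cap_compl (U : {vspace V}) : (U^C :&: U)%VS = 0%VS.
Proof. by rewrite capvC capv_compl. Qed.

Lemma vsval_quotient_proj U v : vsval (quotient_proj U v) = daddv_pi U^C U v.
Proof. by rewrite comp_lfunE lfunE vsprojK // memv_pi. Qed.

Lemma lker_quotient_proj (U : {vspace V}) : lker (quotient_proj U) = U.
Proof.
apply/vspaceP => v; rewrite memv_ker.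
have -> : (quotient_proj U v == 0) = (daddv_pi U^C U v == 0).
  by rewrite -vsval_quotient_proj -(inj_eq val_inj).
have vE : daddv_pi U^C U v + daddv_pi U U^C v = v.
  by apply: daddv_pi_add; rewrite ?cap_compl // addvC addv_complf memvf.
apply/eqP/idP => [v0|vU].
  by rewrite -vE v0 add0r memv_pi.
have := memv_pi U^C U v => vC.
apply/eqP; rewrite -memv0 -(cap_compl U) memv_cap vC /=.
by rewrite -[X in X \in _](addrK (daddv_pi U U^C v)) vE memvB ?memv_pi.
Qed.

Lemma limg_quotient_proj (U : {vspace V}) : limg (quotient_proj U) = fullv.
Proof.
apply/vspaceP => w; rewrite memvf; apply/memv_imgP.
exists (vsval w); first exact: memvf.
apply: val_inj; rewrite /= vsval_quotient_proj daddv_pi_id ?cap_compl //.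
exact: subvsP.
Qed.

End LinearAlgebra.

Section JacobiJordan.
Variables (K : fieldType) (J : vectType K).

(* Multilinear maps are curried. Each level has its own name and vector space
   instance, since bare nested 'Hom types are slow to unify. *)
Definition product := 'Hom(J, 'End(J)).
HB.instance Definition _ := Vector.on product.

Definition linear_form := 'Hom(J, K^o).
HB.instance Definition _ := Vector.on linear_form.

Definition bilinear_form := 'Hom(J, linear_form).
HB.instance Definition _ := Vector.on bilinear_form.

Definition trilinear_form := 'Hom(J, bilinear_form).
HB.instance Definition _ := Vector.on trilinear_form.

Definition jacobi_jordan (m : product) : Prop :=
  (forall x y, m x y = m y x) /\
  (forall x y z, m x (m y z) + m y (m z x) + m z (m x y) = 0).

Definition symmetric_form (B : bilinear_form) : Prop :=
  forall x y, B x y = B y x.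

Definition skew_symmetric_form (c : bilinear_form) : Prop :=
  forall x y, c x y = - c y x.

Definition nondegenerate_form (B : bilinear_form) : Prop :=
  forall x, (forall y, B x y = 0) -> x = 0.

Definition invariant_form (m : product) (B : bilinear_form) : Prop :=
  forall x y z, B (m x y) z = B x (m y z).

Definition pseudo_euclidean (m : product) (B : bilinear_form) : Prop :=
  [/\ jacobi_jordan m, symmetric_form B, nondegenerate_form B
    & invariant_form m B].

Definition invariant_forms (m : product) : {vspace bilinear_form} :=
  span_pred (fun B => symmetric_form B /\ invariant_form m B).

Definition nondegenerate_span (m : product) : {vspace bilinear_form} :=
  span_pred (fun B =>
    [/\ symmetric_form B, invariant_form m B & nondegenerate_form B]).

Definition derivation (m : product) (D : 'End(J)) : Prop :=
  forall x y, D (m x y) = m (D x) y + m x (D y).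

Definition skew_for (B : bilinear_form) (D : 'End(J)) : Prop :=
  forall x y, B (D x) y = - B x (D y).

Definition derivations (m : product) : {vspace 'End(J)} :=
  span_pred (derivation m).

Definition skew_derivations (m : product) (B : bilinear_form)
    : {vspace 'End(J)} :=
  span_pred (fun D => derivation m D /\ skew_for B D).

(* The two adjacent transpositions generate all permutations of the arguments. *)
Definition symmetric_trilinear (c : trilinear_form) : Prop :=
  (forall x y z, c x y z = c y x z) /\ (forall x y z, c x y z = c x z y).

Definition zigzag_cocycle (m : product) (c : trilinear_form) : Prop :=
  symmetric_trilinear c /\
  forall x1 x2 x3 x4,
    c (m x1 x2) x3 x4 + c (m x1 x3) x2 x4 + c (m x1 x4) x2 x3
    + c (m x2 x3) x1 x4 + c (m x2 x4) x1 x3 + c (m x3 x4) x1 x2 = 0.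

Definition zigzag_coboundary (m : product) (f : trilinear_form) : Prop :=
  exists2 c : bilinear_form, skew_symmetric_form c &
    forall x y z, f x y z = - (c (m x y) z + c (m x z) y + c (m y z) x).

Definition zZ3s (m : product) : {vspace trilinear_form} :=
  span_pred (zigzag_cocycle m).

Definition zB3 (m : product) : {vspace trilinear_form} :=
  span_pred (zigzag_coboundary m).

(* The image of zZ3s in trilinear_form / zB3, i.e. zZ3s / zB3 by zB3_sub_zZ3s. *)
Definition zH3s (m : product) : {vspace quotient_space (zB3 m)} :=
  (quotient_proj (zB3 m) @: zZ3s m)%VS.

(* The predicates above other than the nondegenerate one are closed under linear
   combinations, so that span_pred adds nothing to them. *)

Let formE := (zero_lfunE, add_lfunE, scale_lfunE).

Let bil0 (x y : J) : (0 : bilinear_form) x y = 0.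
Proof. by rewrite !zero_lfunE. Qed.

Let bilP (a : K) (f g : bilinear_form) (x y : J) :
  (a *: f + g) x y = a * f x y + g x y.
Proof. by rewrite !formE. Qed.

Let tri0 (x y z : J) : (0 : trilinear_form) x y z = 0.
Proof. by rewrite zero_lfunE bil0. Qed.

Let triP (a : K) (f g : trilinear_form) (x y z : J) :
  (a *: f + g) x y z = a * f x y z + g x y z.
Proof. by rewrite add_lfunE scale_lfunE bilP. Qed.

Lemma mem_invariant_forms m B :
  B \in invariant_forms m <-> symmetric_form B /\ invariant_form m B.
Proof.
apply: (@mem_span_pred _ _ (fun B => symmetric_form B /\ invariant_form m B)).
  by split=> [x y|x y z]; rewrite !formE.
move=> a f g [fs fi] [gs gi]; split=> [x y|x y z]; rewrite !formE.
  by rewrite fs gs.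
by rewrite fi gi.
Qed.

Lemma mem_derivations m D : D \in derivations m <-> derivation m D.
Proof.
apply: mem_span_pred => [x y|a f g fd gd x y].
  by rewrite !formE !linear0 zero_lfunE addr0.
rewrite !formE fd gd !linearP /= !formE.
by rewrite scalerDr addrACA.
Qed.

Lemma mem_skew_derivations m B D :
  D \in skew_derivations m B <-> derivation m D /\ skew_for B D.
Proof.
apply: (@mem_span_pred _ _ (fun D => derivation m D /\ skew_for B D)).
  split; first by apply/mem_derivations/mem0v.
  by move=> x y; rewrite !formE !linear0 zero_lfunE.
move=> a f g [fd fs] [gd gs]; split.
  by apply/mem_derivations/memvD; [apply/memvZ|]; apply/mem_derivations.
move=> x y; rewrite !formE !linearP /= !formE.
by rewrite fs gs scalerN.
Qed.

Lemma mem_zZ3s m c : c \in zZ3s m <-> zigzag_cocycle m c.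
Proof.
apply: mem_span_pred.
  split; first by split=> x y z; rewrite !tri0.
  by move=> x1 x2 x3 x4; rewrite !tri0 !addr0.
move=> a f g [[f1 f2] fz] [[g1 g2] gz]; split.
  by split=> x y z; rewrite !triP; [rewrite f1 g1 | rewrite f2 g2].
move=> x1 x2 x3 x4; rewrite !triP.
have E (p q r s t u p' q' r' s' t' u' : K) :
    p + q + r + s + t + u = 0 -> p' + q' + r' + s' + t' + u' = 0 ->
    (a * p + p') + (a * q + q') + (a * r + r') + (a * s + s') + (a * t + t')
    + (a * u + u') = 0.
  move=> e e'; transitivity (a * (p + q + r + s + t + u) +
    (p' + q' + r' + s' + t' + u')); first by ring.
  by rewrite e e' mulr0 addr0.
exact: E (fz x1 x2 x3 x4) (gz x1 x2 x3 x4).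
Qed.

Lemma mem_zB3 m f : f \in zB3 m <-> zigzag_coboundary m f.
Proof.
apply: mem_span_pred.
  exists 0 => [x y|x y z]; first by rewrite !bil0 oppr0.
  by rewrite tri0 !bil0 !addr0 oppr0.
move=> a f1 f2 [c1 s1 E1] [c2 s2 E2]; exists (a *: c1 + c2) => [x y|x y z].
  by rewrite !bilP s1 s2 mulrN opprD.
rewrite triP !bilP E1 E2.
have E (p q r p' q' r' : K) : a * (- (p + q + r)) - (p' + q' + r') =
    - ((a * p + p') + (a * q + q') + (a * r + r')) by ring.
exact: E.
Qed.

Lemma nondegenerate_span_sub m : (nondegenerate_span m <= invariant_forms m)%VS.
Proof.
by apply: span_pred_min => B [Bs Bi _]; apply/mem_invariant_forms.
Qed.

(* Hence \dim (derivations m) - \dim (skew_derivations m B) is not truncated. *)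
Lemma skew_derivations_sub m B : (skew_derivations m B <= derivations m)%VS.
Proof.
by apply: span_pred_min => D [Dd _]; apply/mem_derivations.
Qed.

Lemma zB3_sub_zZ3s m : jacobi_jordan m -> (zB3 m <= zZ3s m)%VS.
Proof.
move=> [mC mJ]; apply: span_pred_min => f [c cs fE]; apply/mem_zZ3s; split.
  split=> x y z; rewrite !fE.
    by rewrite (mC y x); congr (- _); rewrite addrAC.
  by rewrite (mC z y); congr (- _); rewrite [c (m x y) z + _]addrC.
have cJ x y z t : c (m (m x y) z) t + c (m (m x z) y) t + c (m (m y z) x) t = 0.
  have := congr1 (fun u => c u t) (mJ x y z).
  rewrite !linearD /= !add_lfunE linear0 zero_lfunE => <-.
  rewrite (mC (m x y) z) (mC (m x z) y) (mC (m y z) x) (mC x z).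
  by rewrite addrC [X in _ + X = _]addrC addrA.
move=> x1 x2 x3 x4; rewrite !fE.
have j4 := cJ x1 x2 x3 x4; have j3 := cJ x1 x2 x4 x3.
have j2 := cJ x1 x3 x4 x2; have j1 := cJ x2 x3 x4 x1.
have k1 := cs (m x3 x4) (m x1 x2).
have k2 := cs (m x2 x4) (m x1 x3).
have k3 := cs (m x2 x3) (m x1 x4).
rewrite k1 k2 k3.
have E (a1 a2 a3 b1 b2 b3 d1 d2 d3 e1 e2 e3 p q r : K) :
    a1 + a2 + a3 = 0 -> b1 + b2 + b3 = 0 -> d1 + d2 + d3 = 0 ->
    e1 + e2 + e3 = 0 ->
    - (a1 + b1 - p) - (a2 + d1 - q) - (b2 + d2 - r) - (a3 + e1 + r)
    - (b3 + e2 + q) - (d3 + e3 + p) = 0.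
  move=> a0 b0 d0 e0; transitivity (- ((a1 + a2 + a3) + (b1 + b2 + b3) +
    (d1 + d2 + d3) + (e1 + e2 + e3))); first by ring.
  by rewrite a0 b0 d0 e0 !addr0 oppr0.
exact: E j4 j3 j2 j1.
Qed.

End JacobiJordan.

(* Main.v *)
From HB Require Import structures.
Require Import Defs.
From mathcomp Require Import all_boot all_order all_algebra.
From mathcomp Require Import ring.
Import GRing.Theory.
Local Open Scope ring_scope.

(** The first inequality is an inclusion of spans.  For the second, send an
    invariant symmetric form [F] to the trilinear form [F (x y, z)].  The
    Jacobi identity makes it a cocycle ([product_form_cocycle]), so there is a
    linear map from the invariant forms to the cohomology space, and it remains
    to bound the dimension of its kernel by the codimension of the skew
    derivations in the space of all derivations.

    That codimension is the rank, on derivations, of the map [symmetrization B]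
    taking [D] to the symmetric form [B (D x, y) + B (x, D y)], because the
    endomorphisms killed by it are the skew ones.  So it suffices to see that
    every [F] in the kernel is the symmetrization of a derivation
    ([coboundary_symmetrization]).  Say that [F (x y, z)] is the coboundary of
    the skew form [c].  The form [(F - c) / 2] has [F] as its symmetrization,
    and nondegeneracy of [B] lets one write it as [B (D x, y)]; the coboundary
    equation then says precisely that [D] is a derivation. *)

Section Forms.
Set Implicit Arguments.
Unset Strict Implicit.
Variables (K : fieldType) (J : vectType K).
Implicit Types (m : product J) (B F c : bilinear_form J).

Lemma nondegenerate_represent B (b : bilinear_form J) :
  nondegenerate_form B -> exists D : 'End(J), forall x, B (D x) = b x.
Proof.
move=> Bn.
have kB : lker B = 0%VS.
  apply/vspaceP => x; rewrite memv_ker memv0; apply/eqP/eqP => [Bx|->].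
    by apply: Bn => y; rewrite Bx zero_lfunE.
  exact: linear0.
have imB : limg B = fullv.
  (* [B] is injective into the dual space, which has the same dimension. *)
  apply/eqP; rewrite eqEdim subvf /= limg_dim_eq ?kB ?capv0 //.
  by rewrite !dimvf /dim /= muln1.
exists (B^-1 \o b)%VF => x; rewrite comp_lfunE limg_lfunVK // imB.
exact: memvf.
Qed.

(** A linear map into nested spaces of linear maps is assembled one argument at
    a time: first the linearity in [x] of the partially applied form, then
    that of the resulting form in [F]. *)
Definition product_form_fun m F (x : J) : bilinear_form J := (F \o m x)%VF.

Lemma product_form_fun_linear m F : linear (product_form_fun m F).
Proof.
move=> a x y; apply/lfunP => z.
by rewrite /product_form_fun !(comp_lfunE, add_lfunE, scale_lfunE, linearP).
Qed.
HB.instance Definition _ m F := GRing.isLinear.Build K J (bilinear_form J) _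
  (product_form_fun m F) (product_form_fun_linear m F).

Definition product_form_of m F : trilinear_form J :=
  linfun (product_form_fun m F).

Lemma product_form_ofE m F x y z : product_form_of m F x y z = F (m x y) z.
Proof. by rewrite lfunE /= comp_lfunE. Qed.

Lemma product_form_of_linear m : linear (product_form_of m).
Proof.
move=> a F G; apply/lfunP => x; apply/lfunP => y; apply/lfunP => z.
by rewrite !(product_form_ofE, add_lfunE, scale_lfunE).
Qed.
HB.instance Definition _ m := GRing.isLinear.Build K (bilinear_form J)
  (trilinear_form J) _ (product_form_of m) (product_form_of_linear m).

Definition product_form m : 'Hom(bilinear_form J, trilinear_form J) :=
  linfun (product_form_of m).

Lemma product_formE m F x y z : product_form m F x y z = F (m x y) z.
Proof. by rewrite lfunE product_form_ofE. Qed.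

Definition symmetrization_fun B (D : 'End(J)) (x : J) : linear_form J :=
  B (D x) + (B x \o D)%VF.

Lemma symmetrization_fun_linear B D : linear (symmetrization_fun B D).
Proof.
move=> a x y; apply/lfunP => z; rewrite /symmetrization_fun !linearP /=.
rewrite !(comp_lfunE, add_lfunE, scale_lfunE) /= scalerDr.
by rewrite addrACA.
Qed.
HB.instance Definition _ B D := GRing.isLinear.Build K J (linear_form J) _
  (symmetrization_fun B D) (symmetrization_fun_linear B D).

Definition symmetrization_of B D : bilinear_form J :=
  linfun (symmetrization_fun B D).

Lemma symmetrization_ofE B D x y :
  symmetrization_of B D x y = B (D x) y + B x (D y).
Proof. by rewrite lfunE /= add_lfunE comp_lfunE. Qed.

Lemma symmetrization_of_linear B : linear (symmetrization_of B).
Proof.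
move=> a D E; apply/lfunP => x; apply/lfunP => y.
rewrite !(add_lfunE, scale_lfunE, symmetrization_ofE) !linearP /=.
by rewrite !(add_lfunE, scale_lfunE) scalerDr addrACA.
Qed.
HB.instance Definition _ B := GRing.isLinear.Build K 'End(J)
  (bilinear_form J) _ (symmetrization_of B) (symmetrization_of_linear B).

Definition symmetrization B : 'Hom('End(J), bilinear_form J) :=
  linfun (symmetrization_of B).

Lemma symmetrizationE B D x y :
  symmetrization B D x y = B (D x) y + B x (D y).
Proof. by rewrite lfunE symmetrization_ofE. Qed.

Lemma lker_symmetrization B D : D \in lker (symmetrization B) <-> skew_for B D.
Proof.
rewrite memv_ker; split=> [/eqP D0 x y|Ds].
  apply/eqP; rewrite -addr_eq0 -symmetrizationE D0.
  by rewrite !zero_lfunE.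
apply/eqP/lfunP => x; apply/lfunP => y.
by rewrite symmetrizationE Ds addNr !zero_lfunE.
Qed.

Lemma skew_derivations_cap m B :
  skew_derivations m B = (derivations m :&: lker (symmetrization B))%VS.
Proof.
apply/vspaceP => D; rewrite memv_cap; apply/idP/andP.
  by case/mem_skew_derivations => /mem_derivations ? /lker_symmetrization.
case=> /mem_derivations Dd /lker_symmetrization Ds.
exact/mem_skew_derivations.
Qed.

Lemma dim_symmetrization_derivations m B :
  \dim (symmetrization B @: derivations m)%VS =
  (\dim (derivations m) - \dim (skew_derivations m B))%N.
Proof.
by rewrite -(limg_ker_dim (symmetrization B) (derivations m))
  -skew_derivations_cap addKn.
Qed.

(** By invariance each of the six terms has the form [F (xi xj, xk xl)], so
    the sum is twice the sum over the three ways of splitting the arguments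
    into two pairs; moving [x4] to the second argument of [F] turns that sum
    into [F] applied to the Jacobi sum of [x1, x2, x3] and [x4]. *)
Lemma product_form_cocycle m F :
  jacobi_jordan m -> Defs.symmetric_form F -> invariant_form m F ->
  zigzag_cocycle m (product_form m F).
Proof.
move=> [mC mJ] Fs Fi; split.
  split=> x y z; rewrite !product_formE (mC x y) //.
  by rewrite Fi Fs.
have pairs x y z t : F (m (m x y) z) t = F (m x y) (m z t) by apply: Fi.
move=> x1 x2 x3 x4; rewrite !product_formE !pairs.
rewrite (Fs (m x2 x3)) (Fs (m x2 x4)) (Fs (m x3 x4)).
have J0 : F (m x1 x2) (m x3 x4) + F (m x1 x3) (m x2 x4)
    + F (m x1 x4) (m x2 x3) = 0.
  rewrite (Fs (m x1 x4)) -!pairs -!add_lfunE -!linearD /=.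
  rewrite (_ : _ + _ = 0) ?linear0 ?zero_lfunE // -[RHS](mJ x1 x2 x3).
  rewrite (mC _ x3) (mC (m x1 x3)) (mC (m x2 x3)) (mC x1 x3).
  by rewrite addrC [X in _ + X]addrC addrA.
have E (p q r : K) : p + q + r = 0 -> p + q + r + r + q + p = 0.
  by move=> e; transitivity ((p + q + r) + (p + q + r));
    [ring | rewrite e addr0].
exact: E J0.
Qed.

(** With [B (D x, y) = (F (x, y) - c (x, y)) / 2], invariance of [B] and [F]
    gives
      [2 B (D (xy) - D x y - x D y, z)
         = - F (xy, z) - c (xy, z) + c (x, yz) + c (y, xz)],
    which vanishes, by skew symmetry of [c], exactly when the coboundary
    equation holds at [(x, y, z)]. *)
Lemma coboundary_symmetrization m B F (two_neq0 : (2 : K) != 0) :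
  pseudo_euclidean m B -> Defs.symmetric_form F -> invariant_form m F ->
  zigzag_coboundary m (product_form m F) ->
  F \in (symmetrization B @: derivations m)%VS.
Proof.
move=> [[mC _] Bs Bn Bi] Fs Fi [c cs cE].
have [D DE] := nondegenerate_represent (2^-1 *: (F - c)) Bn.
have {}DE x y : B (D x) y = 2^-1 * (F x y - c x y).
  by rewrite DE !(scale_lfunE, add_lfunE, opp_lfunE).
apply/memv_imgP; exists D; last first.
  apply/lfunP => x; apply/lfunP => y; rewrite symmetrizationE.
  by rewrite (Bs x) !DE (Fs y) (cs y); field.
apply/mem_derivations => x y; apply/eqP; rewrite -subr_eq0; apply/eqP.
apply: Bn => z; rewrite opprD !(linearD, linearN) /=.
rewrite !(add_lfunE, opp_lfunE).
rewrite (mC x (D y)) !Bi !DE -!Fi (mC y x) (cs x) (cs y).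
have := cE x y z; rewrite product_formE => ->; ring.
Qed.

End Forms.

Theorem corollary4 (K : fieldType) (charK0 : [pchar K] =i pred0)
    (J : vectType K) (m : product J) (B : bilinear_form J)
    (JB : pseudo_euclidean m B) :
  (\dim (nondegenerate_span m) <= \dim (invariant_forms m))%N /\
  (\dim (invariant_forms m)
     <= \dim (derivations m) - \dim (skew_derivations m B) + \dim (zH3s m))%N.
Proof.
split; first exact/dimvS/nondegenerate_span_sub.
have two_neq0 : (2 : K) != 0 by rewrite (pcharf0P _).1.
have [JJ _ _ _] := JB.
pose class := (quotient_proj (zB3 m) \o product_form m)%VF.
rewrite -dim_symmetrization_derivations.
(* Rank and nullity of the map that sends [F] to the class of [F (x y, z)]. *)
rewrite -(limg_ker_dim class (invariant_forms m)) leq_add //; apply: dimvS.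
  apply/subvP => F; rewrite memv_cap => /andP[/mem_invariant_forms[Fs Fi]].
  rewrite memv_ker comp_lfunE -memv_ker lker_quotient_proj => /mem_zB3.
  exact: coboundary_symmetrization.
rewrite limg_comp; apply: limgS; apply/subvP => _ /memv_imgP[F + ->].
case/mem_invariant_forms => Fs Fi; apply/mem_zZ3s.
exact: product_form_cocycle.
Qed.
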